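(* Let $A$ and $B$ be sets. The binary hypernormalisation map $\mathcal N\colon\mathcal D(A+B)\to\mathcal D(\mathcal DA+\mathcal DB)$ is equal to the composite function $$\mathcal D(A+B)\xrightarrow{\ \varphi\ }\mathcal DA\star\mathcal DB\xrightarrow{\eta_{\mathcal DA}\star\eta_{\mathcal DB}}\mathcal D\mathcal DA\star\mathcal D\mathcal DB\xrightarrow{\varphi^{-1}}\mathcal D(\mathcal DA+\mathcal DB).$$
   Context: A finitely supported sub-probability distribution on a set $A$ is a function $\omega\colon A\to[0,1]$ with finite support and $\omega(A):=\sum_{a}\omega(a)\le1$; it is a probability distribution if $\omega(A)=1$. $\mathcal DA$ is the set of finitely supported probability distributions on $A$, also written as formal convex combinations $\sum_a\omega(a)\cdot a$; $\eta_A\colon A\to\mathcal DA$ sends $a$ to $1\cdot a$. If $\omega(A)>0$, its normalisation is $\overline\omega(a)=\omega(a)/\omega(A)$. For $r\in[0,1]$ write $r^*=1-r$. Binary hypernormalisation: for $\omega\in\mathcal D(A+B)$ with restrictions $\omega_1$ to $A$ and $\omega_2$ to $B$, $\mathcal N(\omega)\in\mathcal D(\mathcal DA+\mathcal DB)$ is the formal convex combination of those terms among $\omega_1(A)\cdot\overline{\omega_1}$ (with $\overline{\omega_1}$ in the summand $\mathcal DA$) and $\omega_2(B)\cdot\overline{\omega_2}$ (with $\overline{\omega_2}$ in the summand $\mathcal DB$) whose weight is non-zero. An abstract convex space is a set $A$ with an operation $(0,1)\times A\times A\to A$, $(r,a,b)\mapsto r(a,b)$, such that $r(a,a)=a$,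 $r(a,b)=r^*(b,a)$, and $r(s(a,b),c)=(rs)\bigl(a,\tfrac{r s^*}{(rs)^*}(b,c)\bigr)$; one also sets $1(a,b)=a$, $0(a,b)=b$. Convex maps are functions preserving these operations. $\mathcal DA$ is the free abstract convex space on $A$ (pointwise convex combinations, unit $\eta_A$). The coproduct of abstract convex spaces $A,B$ is $A\star B=A+\bigl((0,1)\times A\times B\bigr)+B$, whose elements are viewed as formal convex combinations $s\cdot a+s^*\cdot b$ with $s\in[0,1]$ (a component of weight $0$ being absent; $s=1$ gives the summand $A$, $s=0$ the summand $B$), with $r\bigl(s\cdot a+s^*\cdot b,\;t\cdot a'+t^*\cdot b'\bigr)=p\cdot\bigl(\tfrac{rs}{p}\bigr)_A(a,a')+p^*\cdot\bigl(\tfrac{rs^*}{p^*}\bigr)_B(b,b')$, $p=rs+r^*t$. For arbitrary functions $f\colon A\to A'$, $g\colon B\to B'$ (not necessarily convex), $f\star g=f+\bigl((0,1)\times f\times g\bigr)+g\colon A\star B\to A'\star B'$. The isomorphism $\varphi\colon\mathcal D(A+B)\to\mathcal DA\star\mathcal DB$, defined for any sets $A,B$, is the unique convex map whose restriction along $\eta_{A+B}$ is $A+B\xrightarrow{\eta_A+\eta_B}\mathcal DA+\mathcal DB\hookrightarrow\mathcal DA\star\mathcal DB$ (the canonical comparison of coproducts of free abstract convex spaces). The last map in the composite is the inverse of the instance of $\varphi$ at the sets $\mathcal DA,\mathcal DB$. *)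

(* Defs.v *)
Set Warnings "-notation-incompatible-prefix,-notation-overridden,-ambiguous-paths".
From HB Require Import structures.
From mathcomp Require Import all_boot all_order all_algebra finmap.
From mathcomp Require Import mathcomp_extra boolp classical_sets functions.
From mathcomp Require Import cardinality fsbigop interval_inference reals convex.
From mathcomp Require Import ring lra.

Set Implicit Arguments.
Unset Strict Implicit.
Unset Printing Implicit Defensive.

Import Order.TTheory GRing.Theory Num.Theory.

Local Open Scope classical_set_scope.
Local Open Scope ring_scope.
Local Open Scope convex_scope.

(* Total mass w(A). The finitely supported sum of the library wants a
   choiceType, hence the classical choice structure on the set A. *)
Definition mass (R : realType) (A : Type) (w : A -> R) : R :=
  \sum_(a \in [set: {classic A}]) w a.

(* The bound w a <= 1 need not be a field: see subdist_le1. *)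
Record subdist (R : realType) (A : Type) := SubDist {
  sdfun :> A -> R;
  sd_ge0 : forall a, 0 <= sdfun a;
  sd_fin : finite_set [set a | sdfun a != 0];
  sd_mass : mass sdfun <= 1 }.

Record dist (R : realType) (A : Type) := Dist {
  dfun :> A -> R;
  d_ge0 : forall a, 0 <= dfun a;
  d_fin : finite_set [set a | dfun a != 0];
  d_mass : mass dfun = 1 }.

HB.instance Definition _ (R : realType) (A : Type) := gen_eqMixin (dist R A).
HB.instance Definition _ (R : realType) (A : Type) :=
  gen_choiceMixin (dist R A).

Lemma dist_inj (R : realType) (A : Type) (m n : dist R A) : m =1 n -> m = n.
Proof.
case: m n => [f f0 ff f1] [g g0 gf g1] /= /funext fg; subst g.
by congr Dist; exact: Prop_irrelevance.
Qed.

Section mass_lemmas.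
Context (R : realType).

Lemma mass_fset (A : Type) (X : {fset {classic A}}) (f : A -> R) :
  [set a | f a != 0] `<=` [set` X] -> mass f = \sum_(i <- X) f i.
Proof.
move=> fX; rewrite /mass (@fsbigTE _ _ _ {classic A} X)//= => i iX.
by apply/eqP; apply: contraNT iX => fi; exact: fX.
Qed.

Lemma mass_ge0 (A : Type) (f : A -> R) : (forall a, 0 <= f a) -> 0 <= mass f.
Proof. by move=> f0; exact: fsumr_ge0. Qed.

Lemma mass0 (A : Type) : mass (fun _ : A => 0 : R) = 0.
Proof. by rewrite /mass fsbig1. Qed.

Lemma massZ (A : Type) (k : R) (f : A -> R) :
  mass (fun a => k * f a) = k * mass f.
Proof. by rewrite /mass mulr_fsumr. Qed.

Lemma massD (A : Type) (f g : A -> R) :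
  finite_set [set a | f a != 0] -> finite_set [set a | g a != 0] ->
  mass (fun a => f a + g a) = mass f + mass g.
Proof.
move=> ff gf.
pose X : {fset {classic A}} := (fset_set ([set a | f a != 0] `|` [set a | g a != 0] : set {classic A})).
have XE : [set` X] = [set a | f a != 0] `|` [set a | g a != 0].
  by rewrite /X fset_setK// finite_setU.
rewrite !(@mass_fset _ X) ?big_split// XE.
- by move=> a; right.
- by move=> a; left.
- move=> a /= fg; have [f0|f0] := eqVneq (f a) 0; last by left.
  by right; apply: contra_neq fg => ->; rewrite f0 addr0.
Qed.

Lemma mass_ge1 (A : Type) (f : A -> R) (a : A) :
  (forall a, 0 <= f a) -> finite_set [set a | f a != 0] -> f a <= mass f.
Proof.
move=> f0 ff; pose X : {fset {classic A}} := fset_set ([set a | f a != 0] : set {classic A}).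
have XE : [set` X] = [set a | f a != 0] by rewrite /X fset_setK.
have [->|fa] := eqVneq (f a) 0; first exact: mass_ge0.
rewrite (@mass_fset _ X) ?XE//.
have aX : (a : {classic A}) \in X.
  by have : [set` X] a; [rewrite XE|].
by rewrite (big_fsetD1 (a : {classic A}))//= lerDl sumr_ge0.
Qed.

Lemma mass_point (A : Type) (f : A -> R) (x : A) :
  (forall a, a <> x -> f a = 0) -> mass f = f x.
Proof.
move=> fx; rewrite (@mass_fset _ [fset (x : {classic A})]%fset) ?big_seq_fset1//.
move=> a /= fa; rewrite inE; apply/eqP; apply: contra_notP (negP fa) => ax.
by apply/eqP/fx.
Qed.

Lemma mass_inl (A B : Type) (f : A -> R) :
  mass (fun u : A + B => match u with inl a => f a | inr _ => 0 end) = mass f.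
Proof.
rewrite /mass.
pose h : {classic A} -> {classic (A + B)%type} := inl.
have hi : set_inj [set: {classic A}] h by move=> x y _ _ [].
rewrite -[LHS](@fsbig_widen _ _ _ _ (h @` [set: {classic A}])) //.
  by rewrite fsbig_image.
by move=> [a|b] [_ /= nh]//; exfalso; apply: nh; exists a.
Qed.

Lemma mass_inr (A B : Type) (f : B -> R) :
  mass (fun u : A + B => match u with inl _ => 0 | inr b => f b end) = mass f.
Proof.
rewrite /mass.
pose h : {classic B} -> {classic (A + B)%type} := inr.
have hi : set_inj [set: {classic B}] h by move=> x y _ _ [].
rewrite -[LHS](@fsbig_widen _ _ _ _ (h @` [set: {classic B}])) //.
  by rewrite fsbig_image.
by move=> [a|b] [_ /= nh]//; exfalso; apply: nh; exists b.
Qed.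

Lemma fin_inl (A B : Type) (f : A -> R) : finite_set [set a | f a != 0] ->
  finite_set [set u : A + B | match u with inl a => f a | inr _ => 0 end != 0].
Proof.
move=> ff; apply: (@sub_finite_set _ _ (inl @` [set a | f a != 0])).
  by move=> [a|b] /=; [exists a|rewrite eqxx].
exact: finite_image.
Qed.

Lemma fin_inr (A B : Type) (f : B -> R) : finite_set [set a | f a != 0] ->
  finite_set [set u : A + B | match u with inl _ => 0 | inr b => f b end != 0].
Proof.
move=> ff; apply: (@sub_finite_set _ _ (inr @` [set a | f a != 0])).
  by move=> [a|b] /=; [rewrite eqxx|exists b].
exact: finite_image.
Qed.

Lemma fin_lin (A : Type) (p q : R) (f g : A -> R) :
  finite_set [set a | f a != 0] -> finite_set [set a | g a != 0] ->
  finite_set [set a | p * f a + q * g a != 0].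
Proof.
move=> ff gf.
apply: (@sub_finite_set _ _ ([set a | f a != 0] `|` [set a | g a != 0])).
  move=> a /= fg; have [f0|f0] := eqVneq (f a) 0; last by left.
  by right; apply: contra_neq fg => ->; rewrite f0 !mulr0 addr0.
by rewrite finite_setU.
Qed.

Lemma finZ (A : Type) (p : R) (f : A -> R) :
  finite_set [set a | f a != 0] -> finite_set [set a | p * f a != 0].
Proof.
move=> ff; apply: sub_finite_set ff => a /=.
by apply: contra_neq => ->; rewrite mulr0.
Qed.

Lemma fin_sum (A B : Type) (f : A + B -> R) :
  finite_set [set a | f (inl a) != 0] -> finite_set [set b | f (inr b) != 0] ->
  finite_set [set u | f u != 0].
Proof.
move=> /(fin_inl B) f1 /(fin_inr A) f2.
have := fin_lin 1 1 f1 f2; congr finite_set; apply/funext => -[a|b] /=;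
by rewrite !mul1r ?addr0 ?add0r.
Qed.

Lemma mass_sum (A B : Type) (f : A + B -> R) :
  finite_set [set a | f (inl a) != 0] -> finite_set [set b | f (inr b) != 0] ->
  mass f = mass (f \o inl) + mass (f \o inr).
Proof.
move=> /(fin_inl B) f1 /(fin_inr A) f2.
rewrite -(mass_inl B (f \o inl)) -(mass_inr A (f \o inr)) -massD//.
by congr mass; apply/funext => -[a|b] /=; rewrite ?addr0 ?add0r.
Qed.

Lemma fin_compl (A B : Type) (f : A + B -> R) :
  finite_set [set u | f u != 0] -> finite_set [set a | f (inl a) != 0].
Proof.
move=> ff; apply: (@finite_preimage _ _ _ inl) ff.
by move=> x y _ _ [].
Qed.

Lemma fin_compr (A B : Type) (f : A + B -> R) :
  finite_set [set u | f u != 0] -> finite_set [set a | f (inr a) != 0].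
Proof.
move=> ff; apply: (@finite_preimage _ _ _ inr) ff.
by move=> x y _ _ [].
Qed.

Lemma subdist_le1 (A : Type) (w : subdist R A) a : w a <= 1.
Proof.
by rewrite (le_trans _ (sd_mass w))// mass_ge1//; [exact: sd_ge0|exact: sd_fin].
Qed.

Lemma dist_le1 (A : Type) (w : dist R A) a : w a <= 1.
Proof. by rewrite -(d_mass w) mass_ge1//; [exact: d_ge0|exact: d_fin]. Qed.

End mass_lemmas.

Section eta.
Context (R : realType) (A : Type).

Definition eta_fun (x a : A) : R := `[< a = x >]%:R.

Lemma eta_ge0 x a : 0 <= eta_fun x a.
Proof. by rewrite /eta_fun. Qed.

Lemma eta_fin x : finite_set [set a | eta_fun x a != 0].
Proof.
apply: (@sub_finite_set _ _ [set x]) => // a /=.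
by rewrite /eta_fun; case: asboolP => //; rewrite eqxx.
Qed.

Lemma eta_mass x : mass (eta_fun x) = 1.
Proof.
rewrite (@mass_point _ _ _ x) /eta_fun ?asboolT// => a ax.
by rewrite asboolF.
Qed.

Definition eta (x : A) : dist R A := Dist (eta_ge0 x) (eta_fin x) (eta_mass x).

End eta.
Arguments eta {R A}.

Section dist_convex.
Context (R : realType) (A : Type).
Implicit Types (m n : dist R A) (p : {i01 R}).

Definition dist_conv_fun p m n (a : A) : R :=
  p%:num * m a + (1 - p%:num) * n a.

Lemma dist_conv_ge0 p m n a : 0 <= dist_conv_fun p m n a.
Proof. by rewrite addr_ge0// mulr_ge0// ?d_ge0// subr_ge0. Qed.

Lemma dist_conv_fin p m n : finite_set [set a | dist_conv_fun p m n a != 0].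
Proof. by apply: fin_lin; exact: d_fin. Qed.

Lemma dist_conv_mass p m n : mass (dist_conv_fun p m n) = 1.
Proof.
rewrite massD ?massZ ?d_mass; [|by apply: finZ; exact: d_fin..].
by rewrite !mulr1 addrC subrK.
Qed.

Definition dist_conv p m n : dist R A :=
  Dist (dist_conv_ge0 p m n) (dist_conv_fin p m n) (dist_conv_mass p m n).

Lemma dist_conv1 m n : dist_conv 1%:i01 m n = m.
Proof. by apply: dist_inj => a /=; rewrite /dist_conv_fun /=; ring. Qed.

Lemma dist_convmm p m : dist_conv p m m = m.
Proof. by apply: dist_inj => a /=; rewrite /dist_conv_fun /=; ring. Qed.

Lemma dist_convC p m n :
  dist_conv p m n = dist_conv (1 - p%:inum)%:i01 n m.
Proof. by apply: dist_inj => a /=; rewrite /dist_conv_fun /=; ring. Qed.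

Lemma dist_convA : convex_quasi_associative dist_conv.
Proof.
move=> p q r s a b c prs spq; apply: dist_inj => x /=.
rewrite /dist_conv_fun /= /dist_conv_fun.
have e1 := ConvexQuasiAssoc.pq_sr prs spq.
rewrite !mulrDr !mulrA e1 -spq prs addrA.
by rewrite [s%:num * r%:num]mulrC.
Qed.

HB.instance Definition _ := @isConvexSpace.Build R (dist R A)
  dist_conv dist_conv1 dist_convmm dist_convC dist_convA.

Lemma dist_convE p m n a :
  (m <| p |> n) a = p%:num * m a + (1 - p%:num) * n a.
Proof. by []. Qed.

End dist_convex.

(* The convType operation is indexed by [0,1] instead of (0,1); preservation for
   r = 0 and r = 1 is automatic by conv0 and conv1. *)
Definition convex_map (R : realType) (S T : convType R) (f : S -> T) : Prop :=
  forall (r : {i01 R}) (x y : S), f (x <| r |> y) = f x <| r |> f y.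

(* Truncation to [0,1]. It only serves to type the coefficients r s / p and
   r (1 - s) / (1 - p) of star_conv below, which are in [0,1] (with nonzero denominator)
   whenever they are used: see frac01 and clamp01E. *)
Section clamp.
Context (R : realType).

Lemma clamp_ge0 (x : R) : 0 <= Num.min 1 (Num.max 0 x).
Proof. by rewrite le_min ler01 le_max lexx. Qed.

Lemma clamp_le1 (x : R) : Num.min 1 (Num.max 0 x) <= 1.
Proof. by rewrite ge_min lexx. Qed.

Definition clamp01 (x : R) : {i01 R} := Itv01 (clamp_ge0 x) (clamp_le1 x).

Lemma clamp01E (x : R) : 0 <= x <= 1 -> (clamp01 x)%:num = x.
Proof. by move=> /andP[x0 x1] /=; rewrite max_r// min_r. Qed.

End clamp.

(* The coproduct of A and B, with the weight s of the elements
   s . a + (1 - s) . b of the middle summand on the A-component. *)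
Definition star (R : realType) (A B : convType R) : Type :=
  (A + {s : R | 0 < s < 1} * A * B + B)%type.

HB.instance Definition _ (R : realType) (A B : convType R) :=
  Choice.on (star A B).

Section star.
Context (R : realType) (A B : convType R).

Definition star_inl (a : A) : star A B := inl (inl a).
Definition star_mid (s : {s : R | 0 < s < 1}) (a : A) (b : B) : star A B :=
  inl (inr (s, a, b)).
Definition star_inr (b : B) : star A B := inr b.

(* The formal combination s . a + (1 - s) . b for s in [0,1]: a component
   of weight zero is dropped. *)
Definition fcomb (s : R) (a : A) (b : B) : star A B :=
  match insub s with
  | Some s' => star_mid s' a b
  | None => if s == 1 then star_inl a else star_inr b
  end.

(* The weight s when x is seen as s . a + (1 - s) . b. *)
Definition wt (x : star A B) : R :=
  match x with
  | inl (inl _) => 1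
  | inl (inr (s, _, _)) => val s
  | inr _ => 0
  end.

(* With p = r s + (1 - r) t, the result is the formal combination of
   (r s / p)_A(a, a') with weight p and (r (1 - s) / (1 - p))_B(b, b') with
   weight 1 - p, where a combination one of whose arguments is absent is the
   other argument. *)
Definition star_conv (r : {i01 R}) (x y : star A B) : star A B :=
  let s := wt x in
  let t := wt y in
  let p := r%:num * s + (1 - r%:num) * t in
  let rA := clamp01 (r%:num * s / p) in
  let rB := clamp01 (r%:num * (1 - s) / (1 - p)) in
  match x, y with
  | inl (inl a), inl (inl a') => star_inl (a <| rA |> a')
  | inl (inl a), inl (inr (_, a', b')) => fcomb p (a <| rA |> a') b'
  | inl (inl a), inr b' => fcomb p a b'
  | inl (inr (_, a, b)), inl (inl a') => fcomb p (a <| rA |> a') b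
  | inl (inr (_, a, b)), inl (inr (_, a', b')) =>
      fcomb p (a <| rA |> a') (b <| rB |> b')
  | inl (inr (_, a, b)), inr b' => fcomb p a (b <| rB |> b')
  | inr b, inl (inl a') => fcomb p a' b
  | inr b, inl (inr (_, a', b')) => fcomb p a' (b <| rB |> b')
  | inr b, inr b' => star_inr (b <| rB |> b')
  end.

End star.
Arguments star_inl {R A B}.
Arguments star_mid {R A B}.
Arguments star_inr {R A B}.
Arguments fcomb {R A B}.

(* Non-negative multiples of elements of a convex space form a commutative
   monoid; the coproduct embeds into a product of two of these, which yields the
   axioms of convex spaces. *)
Section cone.
Context (R : realType) (T : convType R).
Implicit Types (u v : R) (a b : T).

Definition cone := option (R * T).

Definition cmk u a : cone := if u == 0 then None else Some (u, a).

Definition cadd (x y : cone) : cone :=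
  match x, y with
  | None, z => z
  | z, None => z
  | Some (u, a), Some (v, b) =>
      Some (u + v, a <| clamp01 (u / (u + v)) |> b)
  end.

Definition cscale (r : R) (x : cone) : cone :=
  if x is Some (u, a) then cmk (r * u) a else None.

Definition cpos (x : cone) : Prop := if x is Some (u, _) then 0 < u else True.

Lemma i01_inj (p q : {i01 R}) : p%:num = q%:num -> p = q.
Proof. exact: val_inj. Qed.

Lemma frac01 u v : 0 <= u -> 0 <= v -> 0 <= u / (u + v) <= 1.
Proof.
move=> u0 v0; rewrite divr_ge0 ?addr_ge0//=.
have [->|uv] := eqVneq (u + v) 0; first by rewrite invr0 mulr0.
have uv0 : 0 < u + v by rewrite lt_neqAle eq_sym uv addr_ge0.
by rewrite ler_pdivrMr// mul1r lerDl.
Qed.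

Lemma clamp0 : clamp01 (0 : R) = 0%:i01.
Proof. by apply: i01_inj; rewrite clamp01E// lexx ler01. Qed.

Lemma clamp1 : clamp01 (1 : R) = 1%:i01.
Proof. by apply: i01_inj; rewrite clamp01E// lexx ler01. Qed.

Lemma cadd_mk u v a b : 0 <= u -> 0 <= v ->
  cadd (cmk u a) (cmk v b) = cmk (u + v) (a <| clamp01 (u / (u + v)) |> b).
Proof.
move=> u0 v0; rewrite /cmk; have [->|un0] := eqVneq u 0.
  by rewrite add0r mul0r clamp0 conv0.
have [->|vn0] := eqVneq v 0.
  by rewrite addr0 (negbTE un0) /= divff// clamp1 conv1.
by rewrite paddr_eq0// (negbTE un0).
Qed.

Lemma cadd0 x : cadd x None = x. Proof. by case: x => [[]|]. Qed.

Lemma caddC x y : cpos x -> cpos y -> cadd x y = cadd y x.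
Proof.
case: x y => [[u a]|] [[v b]|]//= u0 v0; rewrite addrC convC.
congr (Some (_, _ <| _ |> _)); apply: i01_inj.
have uv : v + u != 0 by rewrite gt_eqF// addr_gt0.
transitivity (1 - (clamp01 (u / (v + u)))%:num) => //.
have h1 : 0 <= u / (v + u) <= 1 by rewrite [v + u]addrC frac01 ?ltW.
rewrite (clamp01E h1) (clamp01E (frac01 (ltW v0) (ltW u0))).
by rewrite -{1}(divff uv) -mulrBl addrK.
Qed.

Lemma caddA x y z : cpos x -> cpos y -> cpos z ->
  cadd x (cadd y z) = cadd (cadd x y) z.
Proof.
case: x y z => [[u a]|] [[v b]|] [[w c]|]//= u0 v0 w0.
rewrite addrA; congr (Some (_, _)).
have e1 := @clamp01E _ _ (@frac01 u (v + w) (ltW u0) (addr_ge0 (ltW v0) (ltW w0))).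
have e2 := @clamp01E _ _ (@frac01 v w (ltW v0) (ltW w0)).
have e3 := @clamp01E _ _ (@frac01 u v (ltW u0) (ltW v0)).
have e4 := @clamp01E _ _ (@frac01 (u + v) w (addr_ge0 (ltW u0) (ltW v0)) (ltW w0)).
have n1 : u + v + w != 0 by rewrite gt_eqF// !addr_gt0.
have n2 : v + w != 0 by rewrite gt_eqF// !addr_gt0.
have n3 : u + v != 0 by rewrite gt_eqF// !addr_gt0.
rewrite [u + (v + w)]addrA in e1.
apply: convA; rewrite e1 ?e2 ?e3 ?e4; last rewrite /unstable.onem; field; by rewrite ?n1 ?n2 ?n3.
Qed.

Lemma cscale_mk r u a : cscale r (cmk u a) = cmk (r * u) a.
Proof.
by rewrite /cmk; case: eqVneq => [->|u0] //=; rewrite mulr0 eqxx.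
Qed.

Lemma cscaleD r x y : 0 <= r -> cpos x -> cpos y ->
  cscale r (cadd x y) = cadd (cscale r x) (cscale r y).
Proof.
case: x y => [[u a]|] [[v b]|]//= r0 u0 v0; last by rewrite cadd0.
rewrite cadd_mk ?mulr_ge0 ?(ltW u0) ?(ltW v0)// -mulrDr; have [->|rn0] := eqVneq r 0.
  by rewrite /cmk !mul0r eqxx.
by congr (cmk _ (_ <| clamp01 _ |> _)); rewrite -mulf_div divff// mul1r.
Qed.

Lemma cscaleM r s x : cscale r (cscale s x) = cscale (r * s) x.
Proof.
by case: x => [[u a]|]//=; rewrite cscale_mk mulrA.
Qed.

Lemma cscale0 x : cscale 0 x = None.
Proof. by case: x => [[u a]|]//=; rewrite mul0r /cmk eqxx. Qed.

Lemma cscale1 x : cpos x -> cscale 1 x = x.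
Proof.
by case: x => [[u a]|]//= u0; rewrite mul1r /cmk gt_eqF.
Qed.

Lemma cscaleDl r s x : 0 <= r -> 0 <= s -> cpos x ->
  cadd (cscale r x) (cscale s x) = cscale (r + s) x.
Proof.
case: x => [[u a]|]//= r0 s0 u0.
by rewrite cadd_mk ?mulr_ge0 ?(ltW u0)// convmm mulrDl.
Qed.

Lemma cpos_scale r x : 0 <= r -> cpos x -> cpos (cscale r x).
Proof.
case: x => [[u a]|]//= r0 u0; rewrite /cmk; case: eqVneq => //= ru.
by rewrite lt_neqAle eq_sym ru mulr_ge0// ltW.
Qed.

Lemma cpos_add x y : cpos x -> cpos y -> cpos (cadd x y).
Proof.
by case: x y => [[u a]|] [[v b]|]//=; exact: addr_gt0.
Qed.

End cone.

Section star_convex.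
Context (R : realType) (A B : convType R).
Implicit Types x y : star A B.

Definition conel x : cone A :=
  match x with
  | inl (inl a) => cmk 1 a
  | inl (inr (s, a, _)) => cmk (val s) a
  | inr _ => None
  end.

Definition coner x : cone B :=
  match x with
  | inl (inl _) => None
  | inl (inr (s, _, b)) => cmk (1 - val s) b
  | inr b => cmk 1 b
  end.

Lemma cone_inj x y : conel x = conel y -> coner x = coner y -> x = y.
Proof.
have n1 : (1 == 0 :> R) = false by rewrite oner_eq0.
have [n2 n3] : (forall s : {s : R | 0 < s < 1}, (val s == 0) = false) /\
    (forall s : {s : R | 0 < s < 1}, (1 - val s == 0) = false).
  by split => -[s /= /andP[s0 s1]]; rewrite gt_eqF// subr_gt0.
case: x y => [[a|[[s a] b]]|b] [[a'|[[s' a'] b']]|b'] /=;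
  rewrite /cmk ?n1 ?n2 ?n3 //.
- by move=> [->].
- by move=> [/val_inj -> ->] [->].
- by move=> _ [->].
Qed.

Lemma cpos_l x : cpos (conel x).
Proof.
case: x => [[a|[[[s /= /andP[s0 s1]] a] b]]|b] //=; rewrite /cmk.
  by rewrite oner_eq0 /=.
by rewrite gt_eqF.
Qed.

Lemma cpos_r x : cpos (coner x).
Proof.
case: x => [[a|[[[s /= /andP[s0 s1]] a] b]]|b] //=; rewrite /cmk.
  by rewrite gt_eqF/= subr_gt0.
by rewrite oner_eq0 /=.
Qed.

Lemma conel_fcomb p (a : A) (b : B) : 0 <= p <= 1 -> conel (fcomb p a b) = cmk p a.
Proof.
move=> /andP[p0 p1]; rewrite /fcomb; case: insubP => [s _ <-//|].
rewrite negb_and -!leNgt; case: eqVneq => [->//|pn1] /orP[].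
  by move=> p0'; rewrite /cmk eq_le p0 p0'.
by move=> p1'; move: pn1; rewrite eq_le p1 p1'.
Qed.

Lemma coner_fcomb p (a : A) (b : B) :
  0 <= p <= 1 -> coner (fcomb p a b) = cmk (1 - p) b.
Proof.
move=> /andP[p0 p1]; rewrite /fcomb; case: insubP => [s _ <-//|].
rewrite negb_and -!leNgt; case: eqVneq => [-> _|pn1 /orP[p0'|p1']].
- by rewrite /= subrr /cmk eqxx.
- by have -> : p = 0 by [apply/eqP; rewrite eq_le p0 p0']; rewrite subr0.
- by move: pn1; rewrite eq_le p1 p1'.
Qed.

Lemma wt01 x : 0 <= wt x <= 1.
Proof.
case: x => [[a|[[[s /= /andP[s0 s1]] a] b]]|b] //=; rewrite ?lexx ?ler01//.
by rewrite !ltW.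
Qed.

Lemma mix01 (r : {i01 R}) s t : 0 <= s <= 1 -> 0 <= t <= 1 ->
  0 <= r%:num * s + (1 - r%:num) * t <= 1.
Proof.
move=> /andP[s0 s1] /andP[t0 t1].
have r0 : 0 <= r%:num by [].
have r1 : r%:num <= 1 by [].
by apply/andP; split; nra.
Qed.

Lemma conelD (r : {i01 R}) x y : conel (star_conv r x y) =
  cadd (cscale r%:num (conel x)) (cscale (1 - r%:num) (conel y)).
Proof.
have r0 : 0 <= r%:num by [].
have r1 : 0 <= 1 - r%:num by rewrite subr_ge0.
have /andP[s0 s1] := wt01 x; have /andP[t0 t1] := wt01 y.
have m := mix01 r (wt01 x) (wt01 y).
case: x y s0 s1 t0 t1 m => [[a|[[s a] b]]|b] [[a'|[[s' a'] b']]|b'] /= s0 s1 t0 t1 m;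
  rewrite ?conel_fcomb// ?cscale_mk ?cadd0 ?cadd_mk ?mulr_ge0//= ?mulr0 ?addr0 ?add0r//.
by rewrite !mulr1 [r%:num + _]addrC subrK.
Qed.

Lemma conerD (r : {i01 R}) x y : coner (star_conv r x y) =
  cadd (cscale r%:num (coner x)) (cscale (1 - r%:num) (coner y)).
Proof.
have r0 : 0 <= r%:num by [].
have r1 : 0 <= 1 - r%:num by rewrite subr_ge0.
have /andP[s0 s1] := wt01 x; have /andP[t0 t1] := wt01 y.
have m := mix01 r (wt01 x) (wt01 y).
have E (s t : R) : 1 - (r%:num * s + (1 - r%:num) * t) =
   r%:num * (1 - s) + (1 - r%:num) * (1 - t) by ring.
case: x y s0 s1 t0 t1 m => [[a|[[s a] b]]|b] [[a'|[[s' a'] b']]|b'] /= s0 s1 t0 t1 m;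
  rewrite ?coner_fcomb// ?cscale_mk ?cadd0 ?cadd_mk ?mulr_ge0 ?subr_ge0//= ?E
    ?subrr ?subr0 ?mulr0 ?addr0 ?add0r//.
by rewrite !mulr1 [r%:num + _]addrC subrK.
Qed.

Lemma star_conv1 x y : star_conv 1%:i01 x y = x.
Proof.
apply: cone_inj; rewrite ?conelD ?conerD /= subrr cscale0 cadd0 cscale1//.
  exact: cpos_l.
exact: cpos_r.
Qed.

Lemma star_convmm p x : star_conv p x x = x.
Proof.
have p0 : 0 <= p%:num by [].
have p1 : 0 <= 1 - p%:num by rewrite subr_ge0.
have hl := cpos_l x; have hr := cpos_r x.
by apply: cone_inj; rewrite ?conelD ?conerD cscaleDl// [_ + (1 - _)]addrC subrK cscale1.
Qed.

Lemma star_convC p x y :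
  star_conv p x y = star_conv (1 - p%:inum)%:i01 y x.
Proof.
have p0 : 0 <= p%:num by [].
have p1 : 0 <= 1 - p%:num by rewrite subr_ge0.
have hl := cpos_l; have hr := cpos_r.
apply: cone_inj; rewrite ?conelD ?conerD /= subKr caddC//; exact: cpos_scale.
Qed.

Lemma cone_quasi (T : convType R) (p q r s : {i01 R}) (x y z : cone T) :
  cpos x -> cpos y -> cpos z ->
  p%:num = r%:num * s%:num ->
  1 - s%:num = (1 - p%:num) * (1 - q%:num) ->
  cadd (cscale p%:num x)
    (cscale (1 - p%:num) (cadd (cscale q%:num y) (cscale (1 - q%:num) z))) =
  cadd (cscale s%:num (cadd (cscale r%:num x) (cscale (1 - r%:num) y)))
    (cscale (1 - s%:num) z).
Proof.
move=> hx hy hz prs spq.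
have e1 := ConvexQuasiAssoc.pq_sr prs spq.
have hp (u : {i01 R}) : 0 <= u%:num /\ 0 <= 1 - u%:num.
  by split; rewrite ?subr_ge0.
have [p0 p1] := hp p; have [q0 q1] := hp q.
have [r0 r1] := hp r; have [s0 s1] := hp s.
rewrite [in LHS]cscaleD//; [|exact: cpos_scale..].
rewrite [in RHS]cscaleD//; [|exact: cpos_scale..].
rewrite !cscaleM caddA; [|exact: cpos_scale|by apply: cpos_scale => //; exact: mulr_ge0..].
by rewrite e1 -spq prs [r%:num * _]mulrC.
Qed.

Lemma star_convA : convex_quasi_associative (@star_conv R A B).
Proof.
move=> p q r s x y z prs spq.
have hl := cpos_l; have hr := cpos_r.
by apply: cone_inj; rewrite ?conelD ?conerD; exact: cone_quasi.
Qed.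

HB.instance Definition _ := @isConvexSpace.Build R (star A B)
  (@star_conv R A B) star_conv1 star_convmm star_convC star_convA.

End star_convex.

Definition star_map (R : realType) (A A' B B' : convType R)
    (f : A -> A') (g : B -> B') (x : star A B) : star A' B' :=
  match x with
  | inl (inl a) => star_inl (f a)
  | inl (inr (s, a, b)) => star_mid s (f a) (g b)
  | inr b => star_inr (g b)
  end.

Section restriction.
Context (R : realType) (A B : Type).
Implicit Types w : dist R (A + B).

Lemma restl_mass w : mass (w \o inl) <= 1.
Proof.
rewrite -(d_mass w) mass_sum ?lerDl ?mass_ge0//.
- by move=> b; exact: d_ge0.
- exact: fin_compl (d_fin w).
- exact: fin_compr (d_fin w).
Qed.

Lemma restr_mass w : mass (w \o inr) <= 1.
Proof.
rewrite -(d_mass w) mass_sum ?lerDr ?mass_ge0//.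
- by move=> b; exact: d_ge0.
- exact: fin_compl (d_fin w).
- exact: fin_compr (d_fin w).
Qed.

Definition restl w : subdist R A :=
  @SubDist R A (w \o inl) (fun a => d_ge0 w (inl a)) (fin_compl (d_fin w))
    (restl_mass w).

Definition restr w : subdist R B :=
  @SubDist R B (w \o inr) (fun b => d_ge0 w (inr b)) (fin_compr (d_fin w))
    (restr_mass w).

Lemma rest_mass w : mass (restl w) + mass (restr w) = 1.
Proof.
rewrite -(d_mass w) mass_sum//; first exact: fin_compl (d_fin w).
exact: fin_compr (d_fin w).
Qed.

End restriction.

Section normalisation.
Context (R : realType) (A : Type) (w : subdist R A) (w0 : 0 < mass w).

Definition normalise_fun (a : A) : R := w a / mass w.

Lemma normalise_ge0 a : 0 <= normalise_fun a.
Proof. by rewrite divr_ge0 ?sd_ge0 ?ltW. Qed.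

Lemma normalise_fin : finite_set [set a | normalise_fun a != 0].
Proof.
apply: sub_finite_set (sd_fin w) => a /=.
by apply: contra_neq; rewrite /normalise_fun => ->; rewrite mul0r.
Qed.

Lemma normalise_mass : mass normalise_fun = 1.
Proof.
rewrite /normalise_fun; under [X in mass X]eq_fun do rewrite mulrC.
by rewrite massZ mulVf// gt_eqF.
Qed.

Definition normalise : dist R A :=
  Dist normalise_ge0 normalise_fin normalise_mass.

End normalisation.

Section hypernormalisation.
Context (R : realType) (A B : Type) (w : dist R (A + B)).

(* The formal convex combination of the terms of non-zero weight among
   mass (restl w) . normalise (restl w) and mass (restr w) . normalise (restr w),
   as a function on the disjoint union. *)
Definition hypernorm_fun (u : dist R A + dist R B) : R :=
  match u with
  | inl m => if `[< exists w0 : 0 < mass (restl w), m = normalise w0 >]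
             then mass (restl w) else 0
  | inr n => if `[< exists w0 : 0 < mass (restr w), n = normalise w0 >]
             then mass (restr w) else 0
  end.

Lemma single_term (T : Type) (v : subdist R T) :
  let f := fun m : dist R T =>
    if `[< exists v0 : 0 < mass v, m = normalise v0 >] then mass v else 0 in
  finite_set [set m | f m != 0] /\ mass f = mass v.
Proof.
move=> f; have v0 : 0 <= mass v by apply: mass_ge0; exact: sd_ge0.
have [vp|vn] := boolP (0 < mass v).
  have f0 m : m <> normalise vp -> f m = 0.
    move=> mn; rewrite /f asboolF// => -[v0' mE]; apply: mn.
    by rewrite mE (Prop_irrelevance v0' vp).
  split.
    apply: (@sub_finite_set _ _ [set normalise vp]) => // m /= fm.
    by apply: contrapT => /f0 fm0; move: fm; rewrite fm0 eqxx.
  rewrite (@mass_point _ _ _ (normalise vp))// /f asboolT//.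
  by exists vp.
have m0 : mass v = 0 by apply/eqP; rewrite eq_le v0 leNgt vn.
have -> : f = fun=> 0 by apply/funext => m; rewrite /f; case: ifP => // _; exact: m0.
split; last by rewrite mass0 m0.
by rewrite [X in finite_set X](_ : _ = set0)//; apply/seteqP; split => x //=; rewrite eqxx.
Qed.

Lemma hypernorm_ge0 u : 0 <= hypernorm_fun u.
Proof.
by case: u => m /=; case: ifP => // _; apply: mass_ge0 => a; exact: d_ge0.
Qed.

Lemma hypernorm_fin : finite_set [set u | hypernorm_fun u != 0].
Proof.
apply: fin_sum; first exact: (single_term (restl w)).1.
exact: (single_term (restr w)).1.
Qed.

Lemma hypernorm_mass : mass hypernorm_fun = 1.
Proof.
have [fl ml] := single_term (restl w).
have [fr mr] := single_term (restr w).
by rewrite mass_sum// -[RHS](rest_mass w) -ml -mr.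
Qed.

Definition hypernorm : dist R (dist R A + dist R B) :=
  Dist hypernorm_ge0 hypernorm_fin hypernorm_mass.

End hypernormalisation.

(* A convex map out of a free convex space is determined by its restriction
   along the unit. *)
Lemma convex_map_eta (R : realType) (X : Type) (T : convType R)
    (f g : dist R X -> T) :
  convex_map f -> convex_map g -> f \o eta = g \o eta -> f = g.
Proof.
move=> cf cg fg; apply/funext => w.
have [n] := ubnP #|` fset_set ([set a | w a != 0] : set {classic X})|.
elim: n w => // n IH w wn.
have [x wx] : exists x, w x != 0.
  apply: contrapT => nw; have := d_mass w.
  have -> : dfun w = fun=> 0.
    by apply/funext => x; apply/eqP; apply: contrapT => /negP wx; apply: nw; exists x.
  by rewrite mass0 => /eqP; rewrite eq_sym oner_eq0.
have wx0 : 0 < w x by rewrite lt_neqAle eq_sym wx d_ge0.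
have restE : mass (fun a => w a + - w x * eta x a) = 1 - w x.
  rewrite massD ?massZ ?d_mass ?mulr1//; first exact: d_fin.
  by apply: finZ; exact: d_fin.
have rest0 a : 0 <= w a + - w x * eta x a.
  rewrite /= /eta_fun; case: asboolP => [->|_] /=.
    by rewrite mulr1 subrr.
  by rewrite mulr0 addr0 d_ge0.
have restfin : finite_set [set a | w a + - w x * eta x a != 0].
  have := fin_lin 1 (- w x) (d_fin w) (d_fin (eta x)).
  by under eq_set do rewrite mul1r.
have [w1|w1] := eqVneq (w x) 1.
  have -> : w = eta x.
    apply: dist_inj => a; have := mass_ge1 a rest0 restfin.
    rewrite restE w1 subrr mulN1r subr_le0 => h.
    by apply/eqP; rewrite eq_le h -subr_ge0 -mulN1r -w1 rest0.
  by have := congr1 (fun h => h x) fg.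
have wx1 : 0 < 1 - w x by rewrite subr_gt0 lt_neqAle w1 dist_le1.
pose v0 (a : X) := (1 - w x)^-1 * (w a + - w x * eta x a).
have v0_ge0 a : 0 <= v0 a by rewrite mulr_ge0// invr_ge0 ltW.
have v0_fin : finite_set [set a | v0 a != 0] by exact: finZ.
have v0_mass : mass v0 = 1 by rewrite massZ restE mulVf// gt_eqF.
pose v := Dist v0_ge0 v0_fin v0_mass.
pose r : {i01 R} := Itv01 (ltW wx0) (dist_le1 w x).
have -> : w = eta x <| r |> v.
  apply: dist_inj => a; rewrite dist_convE /= /v0 mulrA divff ?gt_eqF// mul1r /=.
  by ring.
rewrite cf cg; congr (_ <| _ |> _); first by have := congr1 (fun h => h x) fg.
apply: IH; rewrite ltnS in wn; apply: leq_trans wn.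
apply: fproper_ltn_card; rewrite fproperE; apply/andP; split.
  apply/fsubsetP => a; rewrite !in_fset_set ?inE; [|exact: d_fin|exact: v0_fin].
  rewrite /= /v0 /= /eta_fun; case: asboolP => [-> _//|_].
  by rewrite mulr0 addr0; apply: contra_neq => ->; rewrite mulr0.
apply/negP => /fsubsetP /(_ (x : {classic X})).
rewrite !in_fset_set; [|exact: v0_fin|exact: d_fin].
move=> h; have : (x : {classic X}) \in [set a | v a != 0].
  by apply: h; rewrite inE.
by rewrite inE /= /v0 /= /eta_fun asboolT// mulr1 subrr mulr0 eqxx.
Qed.

(* The inverse comparison map, used to show that the comparison map exists and
   is bijective. *)
Section unmix.
Context (R : realType) (A B : Type).
Notation DA := (dist R A).
Notation DB := (dist R B).
Implicit Types x y : star DA DB.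

Definition partl x (a : A) : R :=
  match x with
  | inl (inl m) => m a
  | inl (inr (s, m, _)) => val s * m a
  | inr _ => 0
  end.

Definition partr x (b : B) : R :=
  match x with
  | inl (inl _) => 0
  | inl (inr (s, _, n)) => (1 - val s) * n b
  | inr n => n b
  end.

Definition unmix_fun x (u : A + B) : R :=
  match u with inl a => partl x a | inr b => partr x b end.

Lemma unmix_ge0 x u : 0 <= unmix_fun x u.
Proof.
case: x u => [[m|[[[s /= /andP[s0 s1]] m] n]]|n] [a|b] //=;
by rewrite ?mulr_ge0 ?d_ge0 ?subr_ge0// ltW.
Qed.

Lemma partl_fin x : finite_set [set a | partl x a != 0].
Proof.
case: x => [[m|[[s m] n]]|n] /=; first exact: d_fin.
  by apply: finZ; exact: d_fin.
by rewrite [X in finite_set X](_ : _ = set0)//; apply/seteqP; split => a //=; rewrite eqxx.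
Qed.

Lemma partr_fin x : finite_set [set a | partr x a != 0].
Proof.
case: x => [[m|[[s m] n]]|n] /=; last exact: d_fin.
  by rewrite [X in finite_set X](_ : _ = set0)//; apply/seteqP; split => a //=; rewrite eqxx.
by apply: finZ; exact: d_fin.
Qed.

Lemma partl_mass x : mass (partl x) = wt x.
Proof.
case: x => [[m|[[s m] n]]|n] /=; first exact: d_mass.
  by rewrite [LHS]massZ d_mass mulr1.
exact: mass0.
Qed.

Lemma partr_mass x : mass (partr x) = 1 - wt x.
Proof.
case: x => [[m|[[s m] n]]|n] /=; last by rewrite subr0; exact: d_mass.
  by rewrite subrr; exact: mass0.
by rewrite [LHS]massZ d_mass mulr1.
Qed.

Lemma unmix_fin x : finite_set [set u | unmix_fun x u != 0].
Proof. by apply: fin_sum; [exact: partl_fin|exact: partr_fin]. Qed.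

Lemma unmix_mass x : mass (unmix_fun x) = 1.
Proof.
rewrite mass_sum; [|exact: partl_fin|exact: partr_fin].
by rewrite [X in X + _]partl_mass [X in _ + X]partr_mass addrC subrK.
Qed.

Definition unmix x : dist R (A + B) :=
  Dist (unmix_ge0 x) (unmix_fin x) (unmix_mass x).

Lemma partl_fcomb p (m : DA) (n : DB) a : 0 <= p <= 1 ->
  partl (fcomb p m n) a = p * m a.
Proof.
move=> /andP[p0 p1]; rewrite /fcomb; case: insubP => [s _ <-//|].
rewrite negb_and -!leNgt; case: eqVneq => [-> _|pn1 /orP[p0'|p1']].
- by rewrite mul1r.
- by have -> : p = 0 by [apply/eqP; rewrite eq_le p0 p0']; rewrite mul0r.
- by move: pn1; rewrite eq_le p1 p1'.
Qed.

Lemma partr_fcomb p (m : DA) (n : DB) b : 0 <= p <= 1 ->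
  partr (fcomb p m n) b = (1 - p) * n b.
Proof.
move=> /andP[p0 p1]; rewrite /fcomb; case: insubP => [s _ <-//|].
rewrite negb_and -!leNgt; case: eqVneq => [-> _|pn1 /orP[p0'|p1']].
- by rewrite subrr mul0r.
- by have -> : p = 0 by [apply/eqP; rewrite eq_le p0 p0']; rewrite subr0 mul1r.
- by move: pn1; rewrite eq_le p1 p1'.
Qed.

Lemma clampK (u v : R) : 0 <= u -> 0 <= v ->
  (u + v) * (clamp01 (u / (u + v)))%:num = u /\
  (u + v) * (1 - (clamp01 (u / (u + v)))%:num) = v.
Proof.
move=> u0 v0; rewrite (clamp01E (frac01 u0 v0)).
have [uv|uv] := eqVneq (u + v) 0.
  move/eqP: uv; rewrite paddr_eq0// => /andP[/eqP-> /eqP->].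
  by rewrite addr0 !mul0r.
by split; [rewrite mulrCA divff// mulr1|field].
Qed.

Lemma unmix_convex : convex_map unmix.
Proof.
move=> r x y; apply: dist_inj => u; rewrite dist_convE.
rewrite [x <| r |> y]/(star_conv r x y).
have r0 : 0 <= r%:num by [].
have r1 : 0 <= 1 - r%:num by rewrite subr_ge0.
have m := mix01 r (wt01 x) (wt01 y).
have /andP[s0 s1] := wt01 x; have /andP[t0 t1] := wt01 y.
have E : 1 - (r%:num * wt x + (1 - r%:num) * wt y) =
   r%:num * (1 - wt x) + (1 - r%:num) * (1 - wt y) by ring.
have [l1 l2] := @clampK (r%:num * wt x) ((1 - r%:num) * wt y)
  (mulr_ge0 r0 s0) (mulr_ge0 r1 t0).
have s1' : 0 <= 1 - wt x by rewrite subr_ge0.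
have t1' : 0 <= 1 - wt y by rewrite subr_ge0.
have [k1 k2] := @clampK (r%:num * (1 - wt x)) ((1 - r%:num) * (1 - wt y))
  (mulr_ge0 r0 s1') (mulr_ge0 r1 t1').
rewrite -E in k1 k2.
have mix (p q c d a b : R) : p * q = c -> p * (1 - q) = d ->
    p * (q * a + (1 - q) * b) = c * a + d * b.
  by move=> <- <-; ring.
move: s0 s1 t0 t1 m l1 l2 k1 k2; case: x y u {E s1' t1'} =>
    [[x|[[s x] x']]|x'] [[y|[[t y] y']]|y'] [a|b] /= s0 s1 t0 t1 m l1 l2 k1 k2;
  rewrite ?(partl_fcomb, partr_fcomb)// ?dist_convE ?(mix _ _ _ _ _ _ l1 l2)
    ?(mix _ _ _ _ _ _ k1 k2); try by ring.
- by have := mix _ _ _ _ (x a) (y a) l1 l2;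
  rewrite /dist_conv_fun /=; set q := Num.min _ _; lra.
- by have := mix _ _ _ _ (x' b) (y' b) k1 k2;
  rewrite /dist_conv_fun /=; set q := Num.min _ _; lra.
Qed.

Lemma wt_unmix x y : unmix x = unmix y -> wt x = wt y.
Proof.
move=> xy; rewrite -(partl_mass x) -(partl_mass y); congr mass.
by apply/funext => a; exact: (congr1 (fun w : dist R (A + B) => w (inl a)) xy).
Qed.

Lemma unmix_inj : injective unmix.
Proof.
move=> x y xy; have := wt_unmix xy.
have xyl a : partl x a = partl y a.
  exact: (congr1 (fun w : dist R (A + B) => w (inl a)) xy).
have xyr b : partr x b = partr y b.
  exact: (congr1 (fun w : dist R (A + B) => w (inr b)) xy).
have lt01 (s : {s : R | 0 < s < 1}) : val s != 0 /\ val s != 1 /\ 1 - val s != 0.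
  case: s => s /= /andP[s0 s1]; rewrite gt_eqF// lt_eqF//.
  by rewrite gt_eqF// subr_gt0.
case: x y xyl xyr {xy} => [[m|[[s m] n]]|n] [[m'|[[s' m'] n']]|n'] /= xyl xyr.
- by move=> _; congr (inl (inl _)); exact: dist_inj.
- by move/eqP; rewrite eq_sym (negbTE (lt01 s').2.1).
- by move/eqP; rewrite oner_eq0.
- by move/eqP; rewrite (negbTE (lt01 s).2.1).
- move=> /val_inj ss; subst s'; have [s0 [_ s1]] := lt01 s.
  have -> : m = m' by apply: dist_inj => a; exact: (mulfI s0 (xyl a)).
  by have -> : n = n' by apply: dist_inj => a; exact: (mulfI s1 (xyr a)).
- by move/eqP; rewrite (negbTE (lt01 s).1).
- by move/eqP; rewrite eq_sym oner_eq0.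
- by move/eqP; rewrite eq_sym (negbTE (lt01 s').1).
- by move=> _; congr inr; exact: dist_inj.
Qed.

Lemma unmix_surj (w : dist R (A + B)) : exists x, unmix x = w.
Proof.
have sum1 := rest_mass w.
have l0 : 0 <= mass (restl w) by apply: mass_ge0 => a; exact: d_ge0.
have r0 : 0 <= mass (restr w) by apply: mass_ge0 => a; exact: d_ge0.
have zl : mass (restl w) = 0 -> forall a, w (inl a) = 0.
  move=> z a; apply/eqP; rewrite eq_le d_ge0 andbT -z.
  by apply: (@mass_ge1 _ _ (restl w)) => [b|]; [exact: d_ge0|exact: sd_fin].
have zr : mass (restr w) = 0 -> forall a, w (inr a) = 0.
  move=> z a; apply/eqP; rewrite eq_le d_ge0 andbT -z.
  by apply: (@mass_ge1 _ _ (restr w)) => [b|]; [exact: d_ge0|exact: sd_fin].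
have [lz|lnz] := eqVneq (mass (restl w)) 0.
  have r1 : mass (restr w) = 1 by rewrite -sum1 lz add0r.
  have rp : 0 < mass (restr w) by rewrite r1.
  exists (star_inr (normalise rp)); apply: dist_inj => -[a|b] /=.
    by rewrite zl.
  by rewrite /normalise_fun r1 divr1.
have lp : 0 < mass (restl w) by rewrite lt_neqAle eq_sym lnz.
have [rz|rnz] := eqVneq (mass (restr w)) 0.
  have l1 : mass (restl w) = 1 by rewrite -sum1 rz addr0.
  exists (star_inl (normalise lp)); apply: dist_inj => -[a|b] /=.
    by rewrite /normalise_fun l1 divr1.
  by rewrite zr.
have rp : 0 < mass (restr w) by rewrite lt_neqAle eq_sym rnz.
have s01 : 0 < mass (restl w) < 1 by rewrite lp -sum1 ltrDl.
exists (star_mid (exist (fun s : R => 0 < s < 1) _ s01) (normalise lp) (normalise rp)).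
have E : 1 - mass (restl w) = mass (restr w) by rewrite -sum1 addrC addKr.
apply: dist_inj => -[a|b] /=; rewrite ?E /normalise_fun mulrCA divff ?mulr1//.
Qed.

Lemma unmix_eta (u : A + B) : unmix (match u with
  | inl a => star_inl (eta a) | inr b => star_inr (eta b) end) = eta u.
Proof.
apply: dist_inj; case: u => [a|b] [a'|b'] //=; rewrite /eta_fun;
  by [rewrite asboolF|congr (_%:R); congr (nat_of_bool _);
      apply/asbool_equiv_eq; split => [->|[]]].
Qed.

End unmix.

Section comparison.
Context (R : realType) (A B : Type).
Notation DA := (dist R A).
Notation DB := (dist R B).

Definition is_comparison (f : dist R (A + B) -> star DA DB) : Prop :=
  convex_map f /\
  f \o eta = fun u : A + B =>
    match u with inl a => star_inl (eta a) | inr b => star_inr (eta b) end.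

Lemma is_comparison_cancel f : is_comparison f ->
  cancel f (@unmix R A B) /\ cancel (@unmix R A B) f.
Proof.
move=> [cf fe]; have E : @unmix R A B \o f = id.
  apply: convex_map_eta => //.
    by move=> r x y /=; rewrite cf unmix_convex.
  by apply/funext => u /=; have /= -> := congr1 (fun h => h u) fe; exact: unmix_eta.
have K : cancel f (@unmix R A B) by move=> w; exact: (congr1 (fun h => h w) E).
by split=> // x; apply: unmix_inj; rewrite K.
Qed.

Lemma comparison_ex1 : exists! f, is_comparison f.
Proof.
have [f fK] := choice (@unmix_surj R A B).
exists f; split; last first.
  move=> g [cg ge]; apply: convex_map_eta => //.
    by move=> r x y; apply: unmix_inj; rewrite unmix_convex !fK.
  rewrite ge; apply/funext => u; apply: unmix_inj.
  by rewrite /comp fK unmix_eta.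
split; first by move=> r x y; apply: unmix_inj; rewrite unmix_convex !fK.
by apply/funext => u; apply: unmix_inj; rewrite /comp fK unmix_eta.
Qed.

Definition phi : dist R (A + B) -> star DA DB := sval (cid comparison_ex1).

Lemma phi_comparison : is_comparison phi.
Proof. by rewrite /phi; case: cid => f []. Qed.

Lemma phi_iso : exists g, cancel phi g /\ cancel g phi.
Proof. by exists (@unmix R A B); exact: is_comparison_cancel phi_comparison. Qed.

Definition phi_inv : star DA DB -> dist R (A + B) := sval (cid phi_iso).

Lemma phiK : cancel phi phi_inv.
Proof. by rewrite /phi_inv; case: cid => g []. Qed.

Lemma phi_invK : cancel phi_inv phi.
Proof. by rewrite /phi_inv; case: cid => g []. Qed.

End comparison.
Arguments phi {R A B}.
Arguments phi_inv {R A B}.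

(* Main.v *)
Require Import Defs.
From mathcomp Require Import all_boot all_order all_algebra boolp reals convex.

Import Order.TTheory GRing.Theory Num.Theory.

Local Open Scope ring_scope.

(** The inverse of the comparison map forgets the grouping: it sends
    [s . m + (1 - s) . n] to the distribution equal to [s m] on [A] and to
    [(1 - s) n] on [B]. So a distribution [w] is the image of
    [x = s . m + (1 - s) . n], where [s] is the mass of [w] on [A] and [m], [n] are
    the normalised restrictions. Replacing [m] and [n] by the point masses
    [eta m] and [eta n] and forgetting the grouping again puts mass [s] on [m]
    and [1 - s] on [n], which is the hypernormalisation of [w]. *)

(** As [m] has mass 1, the factor [s] is the mass of [v], so normalising divides it out. *)
Lemma normalise_scale (R : realType) (T : Type) (v : subdist R T)
    (v0 : 0 < mass v) (s : R) (m : dist R T) :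
  (forall a, v a = s * m a) -> normalise v0 = m.
Proof.
move=> vE; have ms : mass v = s.
  by rewrite (funext vE) massZ d_mass mulr1.
apply: dist_inj => a; rewrite /= /normalise_fun vE ms mulrAC divff ?mul1r//.
by rewrite -ms gt_eqF.
Qed.

Lemma hypernorm_term_scale (R : realType) (T : Type) (v : subdist R T) (s : R)
    (m n : dist R T) : 0 < s -> (forall a, v a = s * m a) ->
  (if `[< exists v0 : 0 < mass v, n = normalise v0 >] then mass v else 0) =
  s * eta m n.
Proof.
move=> s0 vE; have ms : mass v = s.
  by rewrite (funext vE) massZ d_mass mulr1.
have v0 : 0 < mass v by rewrite ms.
rewrite /= /eta_fun.
(* Whatever the proof of positivity, the normalisation of [v] is [m]. *)
have -> : `[< exists v0 : 0 < mass v, n = normalise v0 >] = `[< n = m >].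
  apply/asbool_equiv_eq; split => [[v0' ->]|->]; first exact: normalise_scale vE.
  by exists v0; rewrite (normalise_scale _ _ _ _ _ m vE).
by case: ifP; rewrite ?mulr1 ?mulr0.
Qed.

Lemma hypernorm_term0 (R : realType) (T : Type) (v : subdist R T)
    (n : dist R T) : (forall a, v a = 0) ->
  (if `[< exists v0 : 0 < mass v, n = normalise v0 >] then mass v else 0) = 0.
Proof.
move=> vE; have v0 : mass v = 0 by rewrite (funext vE) mass0.
by case: ifP.
Qed.

Lemma hypernorm_unmix (R : realType) (A B : Type)
    (x : star (dist R A) (dist R B)) :
  hypernorm (unmix x) = unmix (star_map eta eta x).
Proof.
apply: dist_inj; case: x => [[m|[[s m] n]]|n] [k|k].
(* A pure element of one summand carries the implicit weight 1, inserted here as the scale. *)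
- rewrite -[RHS]mul1r; apply: (hypernorm_term_scale _ _ (restl _) 1) => // a.
  by rewrite mul1r.
- exact: (hypernorm_term0 _ _ (restr _)).
- case: s => s s01; have /andP[s0 s1] := s01.
  exact: (hypernorm_term_scale _ _ (restl _)).
- case: s => s s01; have /andP[s0 s1] := s01.
  by apply: (hypernorm_term_scale _ _ (restr _)) => //; rewrite subr_gt0.
- exact: (hypernorm_term0 _ _ (restl _)).
- rewrite -[RHS]mul1r; apply: (hypernorm_term_scale _ _ (restr _) 1) => // a.
  by rewrite mul1r.
Qed.

(** [phi_inv] is obtained by choice and has no formula, but any left inverse of the bijection [phi]
    agrees with it. *)
Lemma phi_inv_unmix (R : realType) (A B : Type) :
  @phi_inv R A B =1 @unmix R A B.
Proof.
have [phiU _] := is_comparison_cancel (@phi_comparison R A B).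
by move=> x; rewrite -{2}[x]phi_invK phiU.
Qed.

Theorem proposition9 (R : realType) (A B : Type) :
  @hypernorm R A B =
  @phi_inv R (dist R A) (dist R B) \o star_map (@eta R (dist R A)) (@eta R (dist R B))
    \o @phi R A B.
Proof.
apply/funext => w /=.
by rewrite phi_inv_unmix -hypernorm_unmix -phi_inv_unmix phiK.
Qed.
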